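(* Let $(\mathcal A,(r_\ell)_{\ell\in\mathbb N})$ and $(\mathcal B,(s_\ell)_{\ell\in\mathbb N})$ be two commutative semisimple Fréchet algebras. Then $\mathcal A\oplus\mathcal B$ is a BSE-algebra if and only if both $\mathcal A$ and $\mathcal B$ are BSE-algebras.
   Context: A Fréchet algebra is a complete metrizable (Hausdorff) topological algebra over $\mathbb C$ whose topology is generated by a countable increasing family of submultiplicative seminorms. For a commutative Fréchet algebra $\mathcal C$, $\mathcal C^*$ is its topological dual, and $\Delta(\mathcal C)\subseteq\mathcal C^*$ is the set of all nonzero continuous multiplicative linear functionals $\mathcal C\to\mathbb C$, with the Gelfand topology (topology of pointwise convergence on $\mathcal C$). $\mathcal C$ is semisimple if $\bigcap_{\varphi\in\Delta(\mathcal C)}\ker\varphi=\{0\}$ (equivalently, zero Jacobson radical). Direct sum: $\mathcal A\oplus\mathcal B=\mathcal A\times\mathcal B$ with coordinatewise linear operations and multiplication, and seminorms $P_\ell(a,b)=r_\ell(a)+s_\ell(b)$, $\ell\in\mathbb N$; this is a commutative Fréchet algebra. BSE-functions: for a bounded set $M\subseteq\mathcal C$ and $f\in\mathcal C^*$, put $P_M(f)=\sup_{a\in M}|f(a)|$. A bounded continuous function $\sigma:\Delta(\mathcal C)\to\mathbb C$ is a BSE-function if there exist a bounded set $M\subseteq\mathcal C$ and a real number $\beta_M>0$ such that for all $n$, all $c_1,\dots,c_n\in\mathbb C$ and all $\varphi_1,\dots,\varphi_n\in\Delta(\mathcal C)$, $\left|\sum_{i=1}^n c_i\sigma(\varphi_i)\right|\le\beta_M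 P_M\left(\sum_{i=1}^n c_i\varphi_i\right)$. The set of all BSE-functions is $C_{\mathrm{BSE}}(\Delta(\mathcal C))$. Multipliers: a linear operator $T:\mathcal C\to\mathcal C$ is a multiplier if $aT(b)=T(ab)$ for all $a,b\in\mathcal C$; $\mathrm M(\mathcal C)$ is the set of all multipliers. For $T\in\mathrm M(\mathcal C)$ there is a unique continuous function $\widehat T$ on $\Delta(\mathcal C)$ with $\varphi(T(a))=\widehat T(\varphi)\varphi(a)$ for all $a\in\mathcal C$, $\varphi\in\Delta(\mathcal C)$. Put $\widehat{\mathrm M(\mathcal C)}=\{\widehat T:T\in\mathrm M(\mathcal C)\}$. $\mathcal C$ is a BSE-algebra if $\widehat{\mathrm M(\mathcal C)}=C_{\mathrm{BSE}}(\Delta(\mathcal C))$. *)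

(* Defs.v *)
From HB Require Import structures.
From mathcomp Require Import all_boot all_order all_algebra.
From mathcomp Require Import all_classical all_reals all_analysis.
From mathcomp Require Import complex.

Set Implicit Arguments.
Unset Strict Implicit.
Unset Printing Implicit Defensive.

Import Order.TTheory GRing.Theory Num.Theory.
Import numFieldNormedType.Exports.

Local Open Scope classical_set_scope.
Local Open Scope complex_scope.
Local Open Scope ring_scope.

(* The field of complex numbers is R[i]. This is the modulus as an element of R; the norm `|z| of z : R[i] lives in R[i]. *)
Notation normc := Normc.normc.

(* Algebras need not be unital, hence MathComp's ring structures do not apply.
   [entourage_seminorm] says that the uniform structure, and therefore the
   topology, is the one generated by the (increasing) seminorms; [Tvs] alone
   does not tie the uniformity to the linear structure. Completeness is stated
   as in [Uniform_isComplete], whose structure would require a chosen point. *)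
HB.mixin Record isFrechetAlgebra (R : realType) (A : Type)
    & Tvs R[i] A := {
  amul : A -> A -> A;
  amulA : associative amul;
  amulDl : left_distributive amul +%R;
  amulDr : right_distributive amul +%R;
  amulZl : forall (k : R[i]) (x y : A), amul (k *: x) y = k *: amul x y;
  amulZr : forall (k : R[i]) (x y : A), amul x (k *: y) = k *: amul x y;
  seminorm : nat -> A -> R;
  seminormD : forall l (x y : A),
    seminorm l (x + y) <= seminorm l x + seminorm l y;
  seminormZ : forall l (k : R[i]) (x : A),
    seminorm l (k *: x) = normc k * seminorm l x;
  seminormM : forall l (x y : A),
    seminorm l (amul x y) <= seminorm l x * seminorm l y;
  seminorm_incr : forall l (x : A), seminorm l x <= seminorm l.+1 x;
  entourage_seminorm : forall U : set (A * A), entourage U <->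
    exists (l : nat) (e : R), 0 < e /\
      (forall x y : A, seminorm l (x - y) < e -> U (x, y));
  frechet_complete : forall F : set_system A,
    ProperFilter F -> cauchy F -> exists a : A, F --> a;
  frechet_hausdorff : hausdorff_space A
}.

#[short(type="frechetAlgType")]
HB.structure Definition FrechetAlgebra (R : realType) :=
  {A of isFrechetAlgebra R A & Tvs R[i] A}.

HB.mixin Record FrechetAlgebra_isCommutative (R : realType) (A : Type)
    & FrechetAlgebra R A := {
  amulC : commutative (amul : A -> A -> A)
}.

#[short(type="comFrechetAlgType")]
HB.structure Definition ComFrechetAlgebra (R : realType) :=
  {A of FrechetAlgebra_isCommutative R A & FrechetAlgebra R A}.

Section seminorm_theory.
Variables (R : realType) (A : frechetAlgType R).
Implicit Types a : A.

Lemma seminorm0 l : seminorm l (0 : A) = 0 :> R.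
Proof. by rewrite -(scale0r (0 : A)) seminormZ Normc.normc0 mul0r. Qed.

Lemma seminormN l a : seminorm l (- a) = seminorm l a :> R.
Proof.
rewrite -scaleN1r seminormZ -[RHS]mul1r; congr (_ * _).
by rewrite /= oppr0 sqrrN expr1n expr0n addr0 sqrtr1.
Qed.

Lemma seminorm_ge0 l a : 0 <= seminorm l a :> R.
Proof.
have := seminormD l a (- a); rewrite subrr seminorm0 seminormN.
by rewrite -mulr2n pmulrn_lge0.
Qed.

Lemma seminorm_le l m a : (l <= m)%N -> seminorm l a <= seminorm m a :> R.
Proof.
move=> /subnK <-; elim: (m - l)%N => // k ih.
by rewrite addSn (le_trans ih)// seminorm_incr.
Qed.

End seminorm_theory.

Section frechet_sum.
Variables (R : realType) (A B : frechetAlgType R).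
Implicit Types x y : (A * B)%type.

Definition sum_mul x y : (A * B)%type := (amul x.1 y.1, amul x.2 y.2).

Definition sum_seminorm (l : nat) x : R := seminorm l x.1 + seminorm l x.2.

Let sum_mulA : associative sum_mul.
Proof. by move=> x y z; rewrite /sum_mul/= !amulA. Qed.

Let sum_mulDl : left_distributive sum_mul +%R.
Proof. by move=> x y z; rewrite /sum_mul/= !amulDl. Qed.

Let sum_mulDr : right_distributive sum_mul +%R.
Proof. by move=> x y z; rewrite /sum_mul/= !amulDr. Qed.

Let sum_mulZl (k : R[i]) x y : sum_mul (k *: x) y = k *: sum_mul x y.
Proof. by rewrite /sum_mul/= !amulZl. Qed.

Let sum_mulZr (k : R[i]) x y : sum_mul x (k *: y) = k *: sum_mul x y.
Proof. by rewrite /sum_mul/= !amulZr. Qed.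

Let sum_seminormD l x y :
  sum_seminorm l (x + y) <= sum_seminorm l x + sum_seminorm l y.
Proof. by rewrite /sum_seminorm addrACA lerD// seminormD. Qed.

Let sum_seminormZ l (k : R[i]) x :
  sum_seminorm l (k *: x) = normc k * sum_seminorm l x.
Proof. by rewrite /sum_seminorm/= !seminormZ mulrDr. Qed.

Let sum_seminormM l x y :
  sum_seminorm l (sum_mul x y) <= sum_seminorm l x * sum_seminorm l y.
Proof.
rewrite /sum_seminorm/= mulrDl !mulrDr lerD//.
  by rewrite (le_trans (seminormM _ _ _))// lerDl mulr_ge0// seminorm_ge0.
by rewrite (le_trans (seminormM _ _ _))// lerDr mulr_ge0// seminorm_ge0.
Qed.

Let sum_seminorm_incr l x : sum_seminorm l x <= sum_seminorm l.+1 x.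
Proof. by rewrite lerD// seminorm_incr. Qed.

Let sum_entourage_seminorm (U : set ((A * B) * (A * B))) : entourage U <->
  exists (l : nat) (e : R), 0 < e /\
    (forall x y, sum_seminorm l (x - y) < e -> U (x, y)).
Proof.
split=> [[[UA UB]] /= [/entourage_seminorm[l [e [e0 lU]]]
    /entourage_seminorm[m [d [d0 mU]]]] UU|[l [e [e0 lU]]]].
  exists (maxn l m), (Num.min e d); split; first by rewrite lt_min e0.
  move=> [a b] [a' b']; rewrite lt_min => /andP[xye xyd].
  have [|[[? ?] [? ?]] /= + [<- <- <- <-]//] := UU ((a, a'), (b, b')).
  split=> /=.
    apply: lU; apply: le_lt_trans xye.
    rewrite (le_trans (seminorm_le _ (leq_maxl l m)))// /sum_seminorm lerDl.
    exact: seminorm_ge0.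
  apply: mU; apply: le_lt_trans xyd.
  rewrite (le_trans (seminorm_le _ (leq_maxr l m)))// /sum_seminorm lerDr.
  exact: seminorm_ge0.
have e20 : 0 < e / 2 by rewrite divr_gt0.
exists ([set u | seminorm l (u.1 - u.2) < e / 2],
        [set u | seminorm l (u.1 - u.2) < e / 2]) => /=.
  by split; apply/entourage_seminorm; exists l, (e / 2).
move=> [[a a'] [b b']] /= [aa' bb'].
exists ((a, b), (a', b')) => //=; apply: lU.
by rewrite [e]splitr ltrD.
Qed.

Let sum_complete (F : set_system (A * B)) :
  ProperFilter F -> cauchy F -> exists x, F --> x.
Proof.
move=> FF Fc.
have [|a Fa] := @frechet_complete R A (fst @ F) _.
  move=> U entU.
  have [|[P Q] /= [FP FQ] PQ] := Fc [set u | U (u.1.1, u.2.1)].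
    exists (U, setT); first by split => //; exact: entourageT.
    by move=> [[a a'] [b b']] [? _]; exists ((a, b), (a', b')).
  exists (fst @` P, fst @` Q).
    by split; [apply: (filterS _ FP) | apply: (filterS _ FQ)] => x ?; exists x.
  by move=> [_ _] /= [[x Px <-] [y Qy <-]]; exact: (PQ (x, y)).
have [|b Fb] := @frechet_complete R B (snd @ F) _.
  move=> U entU.
  have [|[P Q] /= [FP FQ] PQ] := Fc [set u | U (u.1.2, u.2.2)].
    exists (setT, U); first by split => //; exact: entourageT.
    by move=> [[a1 a2] [b1 b2]] [_ ?]; exists ((a1, b1), (a2, b2)).
  exists (snd @` P, snd @` Q).
    by split; [apply: (filterS _ FP) | apply: (filterS _ FQ)] => x ?; exists x.
  by move=> [_ _] /= [[x Px <-] [y Qy <-]]; exact: (PQ (x, y)).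
exists (a, b) => U [[P Q] /= [aP bQ] PQU].
have FP : F (fst @^-1` P) := Fa _ aP.
have FQ : F (snd @^-1` Q) := Fb _ bQ.
by apply: (filterS _ (filterI FP FQ)) => x ?; exact: PQU.
Qed.

Let sum_hausdorff : hausdorff_space (A * B)%type.
Proof.
move=> [a b] [a' b'] abcl; congr (_, _).
  apply: (@frechet_hausdorff R A) => P Q aP aQ.
  have [|| x [/= Px Qx]] := abcl (P `*` setT) (Q `*` setT).
  - by exists (P, setT) => //; split=> //; exact: filterT.
  - by exists (Q, setT) => //; split=> //; exact: filterT.
  by exists x.1; split; [case: Px | case: Qx].
apply: (@frechet_hausdorff R B) => P Q aP aQ.
have [|| x [/= Px Qx]] := abcl (setT `*` P) (setT `*` Q).
- by exists (setT, P) => //; split=> //; exact: filterT.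
- by exists (setT, Q) => //; split=> //; exact: filterT.
by exists x.2; split; [case: Px | case: Qx].
Qed.

HB.instance Definition _ := isFrechetAlgebra.Build R (A * B)%type
  sum_mulA sum_mulDl sum_mulDr sum_mulZl sum_mulZr
  sum_seminormD sum_seminormZ sum_seminormM sum_seminorm_incr
  sum_entourage_seminorm sum_complete sum_hausdorff.

End frechet_sum.

Section com_frechet_sum.
Variables (R : realType) (A B : comFrechetAlgType R).

Let sum_mulC : commutative (amul : A * B -> A * B -> A * B)%type.
Proof. by move=> x y; congr (_, _); exact: amulC. Qed.

HB.instance Definition _ :=
  FrechetAlgebra_isCommutative.Build R (A * B)%type sum_mulC.

End com_frechet_sum.

Section BSE.
Variables (R : realType) (C : comFrechetAlgType R).

(* Functionals live in the space of all functions with the topology of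
   pointwise convergence, from which the subtype [characters] inherits the
   Gelfand topology. R[i]^o is R[i] with its norm topology. *)
Definition characters : set {ptws C -> R[i]^o} :=
  [set phi | [/\ linear (phi : C -> R[i]^o),
                 continuous (phi : C -> R[i]^o),
                 forall a b : C, phi (amul a b) = phi a * phi b
               & exists a : C, phi a != 0]].

Definition semisimple : Prop :=
  \bigcap_(phi in characters) [set a : C | phi a = 0] = [set 0].

Definition bounded_subset (M : set C) : Prop :=
  forall l : nat, exists K : R, forall a : C, M a -> seminorm l a <= K.

(* [sup set0 = 0]: the empty set behaves like [set 0]. *)
Definition sup_on (M : set C) (f : C -> R[i]^o) : R :=
  sup [set normc (f a) | a in M].

Definition BSE_functions : set (characters -> R[i]^o) :=
  [set sigma : characters -> R[i]^o | [/\ continuous sigma,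
    exists K : R, forall phi : characters, normc (sigma phi) <= K
  & exists (M : set C) (beta : R), [/\ bounded_subset M, 0 < beta &
      forall (n : nat) (c : 'I_n -> R[i]) (phi : 'I_n -> characters),
        normc (\sum_(i < n) c i * sigma (phi i))
        <= beta * sup_on M (fun a : C => \sum_(i < n) c i * set_val (phi i) a)]]].

Definition multiplier (T : C -> C) : Prop :=
  linear T /\ forall a b : C, amul a (T b) = T (amul a b).

(* [sigma] is the (unique) function \hat T. *)
Definition multiplier_transform (T : C -> C) (sigma : characters -> R[i]^o) :
    Prop :=
  continuous sigma /\
  forall (a : C) (phi : characters),
    set_val phi (T a) = sigma phi * set_val phi a.

Definition multiplier_transforms : set (characters -> R[i]^o) :=
  [set sigma | exists2 T : C -> C, multiplier T & multiplier_transform T sigma].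

Definition BSE_algebra : Prop := multiplier_transforms = BSE_functions.

End BSE.

Arguments semisimple {R} C.
Arguments BSE_algebra {R} C.

(* Main.v *)
Require Import Defs.
From HB Require Import structures.
From mathcomp Require Import all_boot all_order all_algebra.
From mathcomp Require Import all_classical all_reals all_analysis.
From mathcomp Require Import complex.

(* Every character of A * B factors through exactly one of the two projections,
   because the images of A and B annihilate each other; hence the Gelfand space
   of A * B is the topological disjoint union of those of A and B. Functions on
   it are thus pairs of functions, and a pair is a multiplier transform (resp. a
   BSE-function) iff both components are: multipliers act diagonally, and for a
   BSE bound one takes the union of M_A * 0 and 0 * M_B. Pairing with the zero
   function, which is both a multiplier transform and a BSE-function, transfers
   the BSE property from A * B to each factor. *)

Set Implicit Arguments.
Unset Strict Implicit.
Unset Printing Implicit Defensive.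

Import Order.TTheory GRing.Theory Num.Theory.
Import numFieldNormedType.Exports.

Local Open Scope classical_set_scope.
Local Open Scope ring_scope.

Local Notation chars C := (@characters _ C).

(** * Gelfand topology: convergence tested pointwise *)

Section character_topology.
Variables (R : realType) (C : comFrechetAlgType R).

Lemma eval_continuous (a : C) :
  continuous (fun chi : chars C => set_val chi a : R[i]^o).
Proof.
move=> chi.
exact: (continuous_comp (@initial_continuous _ _ _ chi)
                        (@proj_continuous _ _ a _)).
Qed.

(** The Gelfand topology is initial for the inclusion into the functions with pointwise convergence,
    so convergence can be tested at each element. *)
Lemma cvg_charP (T : topologicalType) (x : T) (g : T -> chars C)
    (chi : chars C) :
  (forall a : C, (set_val (g t) a : R[i]^o) @[t --> x] --> set_val chi a) ->
  g t @[t --> x] --> chi.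
Proof.
move=> h.
have H : {ptws, (set_val \o g) t @[t --> x] --> set_val chi}.
  by apply/(@pointwise_cvgP C R[i]^o).
move=> U [_ [[V oV <-] Vc] VU].
have : nbhs x ((set_val \o g) @^-1` V) by apply: H; exact: open_nbhs_nbhs.
apply: filterS => t; exact: VU.
Qed.

End character_topology.

(** * Characters, suprema over bounded sets, and the zero function *)

Section characters_theory.
Variables (R : realType) (C : comFrechetAlgType R).

(** A named form of [set_val] that can carry the linear structure declared below. *)
Definition ev (chi : chars C) : C -> R[i]^o := set_val chi.

Lemma ev_characters chi : @characters R C (ev chi).
Proof. exact: set_valP. Qed.

Let ev_linear chi : linear (ev chi).
Proof. by case: (ev_characters chi). Qed.

HB.instance Definition _ chi :=
  GRing.isLinear.Build R[i] C R[i]^o *:%R (ev chi) (ev_linear chi).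

Lemma evM chi a b : ev chi (amul a b) = ev chi a * ev chi b.
Proof. by case: (ev_characters chi). Qed.

Lemma ev_neq0 chi : exists a, ev chi a != 0.
Proof. by case: (ev_characters chi). Qed.

Lemma ev_continuous chi : continuous (ev chi).
Proof. by case: (ev_characters chi). Qed.

Lemma ev_inj : injective ev.
Proof. exact: val_inj. Qed.

Lemma near_ev_neq0 chi a :
  ev chi a != 0 -> \forall x \near chi, ev x a != 0.
Proof.
by apply: (cvgr_neq0 (F := nbhs chi)); exact: eval_continuous.
Qed.

Lemma character_bounded_on (chi : chars C) (M : set C) : bounded_subset M ->
  exists K : R, forall a, M a -> normc (ev chi a) <= K.
Proof.
move=> Mb.
have /(@nbhsP C)[E /entourage_seminorm[l [e [e0 lE]]] EU] :
    \forall a \near (0 : C), `|ev chi a| < 1.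
  apply: cvgr0_norm_lt => //.
  by rewrite -(linear0 (ev chi)); exact: ev_continuous.
have [K MK] := Mb l.
(* Scaling by [t] moves [M] into the ball of radius [e] of the seminorm, where [chi] has modulus
   below 1. *)
pose t := e / (`|K| + 1).
have K0 : 0 < `|K| + 1 by rewrite ltr_wpDl.
have t0 : 0 < t by rewrite divr_gt0.
have normct : normc t%:C%C = t by rewrite /= expr0n addr0 sqrtr_sqr gtr0_norm.
exists t^-1 => a /MK aK.
have : xsection E 0 (t%:C%C *: a).
  rewrite /xsection /= inE; apply: lE; rewrite sub0r seminormN seminormZ normct.
  rewrite /t mulrAC ltr_pdivrMr// ltr_pM2l// (le_lt_trans aK)//.
  by rewrite (le_lt_trans (ler_norm _))// ltrDl.
move/EU; rewrite /= linearZ/= => h.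
have : (normc (t%:C%C * ev chi a))%:C%C < (1 : R)%:C%C by exact: h.
by rewrite ltcR Normc.normcM normct mulrC -ltr_pdivlMr// div1r => /ltW.
Qed.

Lemma sup_on_ge0 (M : set C) (f : C -> R[i]^o) : 0 <= sup_on M f.
Proof.
rewrite /sup_on; set S := [set _ | _ in _].
have [[[_ [a Ma _]] Sub]|/sup_out S0] := pselect (has_sup S); last first.
  by rewrite S0.
apply: (@le_trans _ _ (normc (f a))).
  by case: (f a) => x y; rewrite sqrtr_ge0.
by apply: ub_le_sup => //; exists a.
Qed.

(** As [sup] is 0 on unbounded sets, monotonicity requires the larger supremum to be finite;
    characters are bounded on bounded sets, hence so are their combinations. *)
Lemma sup_on_le (M N : set C) n (c : 'I_n -> R[i]) (chi : 'I_n -> chars C) :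
  bounded_subset N -> M `<=` N ->
  sup_on M (fun a => \sum_(k < n) c k * ev (chi k) a) <=
  sup_on N (fun a => \sum_(k < n) c k * ev (chi k) a).
Proof.
move=> Nb MN; set f := fun a : C => _.
have [M0|/set0P[a0 Ma0]] := eqVneq M set0.
  by rewrite {1}/sup_on M0 image_set0 sup0 sup_on_ge0.
apply: sup_le_ub; first by exists (normc (f a0)), a0.
have [K NK] : exists K : 'I_n -> R,
    forall k a, N a -> normc (ev (chi k) a) <= K k.
  have ub k := character_bounded_on (chi k) Nb.
  by exists (fun k => sval (cid (ub k))) => k; exact: svalP (cid (ub k)).
move=> _ [a Ma <-]; apply: ub_le_sup; last by exists a => //; exact: MN.
exists (\sum_(k < n) normc (c k) * K k) => _ [b Nb' <-].
rewrite /f; elim/big_ind2 : _ => [|x1 x2 y1 y2 h1 h2|k _].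
- by rewrite Normc.normc0.
- by rewrite (le_trans (le_normcD _ _))// lerD.
- rewrite Normc.normcM ler_wpM2l//; last exact: NK.
  by case: (c k) => x y; rewrite sqrtr_ge0.
Qed.

Lemma multiplier_transforms0 : @multiplier_transforms R C (fun=> 0).
Proof.
exists (fun=> 0).
  split=> [k a b|a b]; first by rewrite scaler0 addr0.
  by rewrite -(scale0r (0 : C)) amulZr !scale0r.
split=> [x|a phi]; first exact: (@cvg_cst _ _ _ (nbhs x)).
by rewrite mul0r -/(ev phi _) linear0.
Qed.

Lemma BSE_functions0 : @BSE_functions R C (fun=> 0).
Proof.
split=> [x||]; first exact: (@cvg_cst _ _ _ (nbhs x)).
  by exists 0 => phi; rewrite Normc.normc0.
exists set0, 1; split=> // [l|n c phi]; first by exists 0.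
rewrite big1 => [|k _]; last by rewrite mulr0.
by rewrite Normc.normc0 mul1r sup_on_ge0.
Qed.

End characters_theory.

(** * Transfer between an algebra and a direct factor of it *)

Section direct_factor.
Variables (R : realType) (A C : comFrechetAlgType R).
Variables (i : {linear A -> C}) (p : {linear C -> A}).

(* [i] embeds [A] as an ideal of [C] on which [p] is a projection. *)
Record direct_factor : Prop := DirectFactor {
  proj_cont : continuous p;
  inj_cont : continuous i;
  proj_seminorm : forall l c, seminorm l (p c) <= seminorm l c :> R;
  inj_seminorm : forall l a, seminorm l (i a) <= seminorm l a :> R;
  projM : forall c d, p (amul c d) = amul (p c) (p d);
  injK : cancel i p;
  inj_ideal : forall c a, amul c (i a) = i (amul (p c) a) }.

Hypothesis ip : direct_factor.

Lemma injM a b : i (amul a b) = amul (i a) (i b).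
Proof. by rewrite (inj_ideal ip) (injK ip). Qed.

Lemma inflate_characters (phi : chars A) : @characters R C (ev phi \o p).
Proof.
split=> [k c d|c|c d|].
- by rewrite /= !linearP.
- exact: (continuous_comp (@proj_cont ip c) (@ev_continuous _ _ phi _)).
- by rewrite /= (projM ip) evM.
- by have [a a0] := ev_neq0 phi; exists (i a); rewrite /= (injK ip).
Qed.

Definition inflate (phi : chars A) : chars C :=
  SigSub (mem_set (inflate_characters phi)).

(** [None] stands for a character that vanishes on the ideal [i A], as its restriction is then no
    character. *)
Definition restrict (chi : chars C) : option (chars A) :=
  insub (ev chi \o i : {ptws A -> R[i]^o}).

Definition extend (s : chars A -> R[i]^o) (chi : chars C) : R[i]^o :=
  oapp s 0 (restrict chi).

Lemma ev_inflate phi c : ev (inflate phi) c = ev phi (p c).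
Proof. by []. Qed.

Lemma restrict_inflate phi : restrict (inflate phi) = Some phi.
Proof.
rewrite /restrict; have -> : ev (inflate phi) \o i = val phi.
  by apply/funext => a; rewrite /= ev_inflate (injK ip).
exact: valK.
Qed.

(** The composite of [chi] and [i] is linear, continuous and multiplicative, so it can fail to be a
    character only by being zero. *)
Lemma ev_inj_restrict chi a :
  ev chi (i a) = oapp (fun phi => ev phi a) 0 (restrict chi).
Proof.
rewrite /restrict; case: insubP => [phi _ phiE|/negP chii] /=.
  by rewrite /ev [set_val phi]phiE.
apply/eqP/negPn/negP => chia; apply: chii; apply/mem_set; split.
- by move=> k x y; rewrite /= !linearP.
- move=> x.
  exact: (continuous_comp (@inj_cont ip x) (@ev_continuous _ _ chi _)).
- by move=> x y; rewrite /= injM evM.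
- by exists a.
Qed.

(** With [phi a] nonzero, chi(c) phi(a) = chi(c i(a)) = chi(i(p(c) a)) = phi(p(c)) phi(a); cancel
    phi(a). *)
Lemma restrict_Some chi phi : restrict chi = Some phi -> chi = inflate phi.
Proof.
move=> chiphi; apply: ev_inj; apply/funext => c; rewrite ev_inflate.
have evi a : ev chi (i a) = ev phi a by rewrite ev_inj_restrict chiphi.
have [a a0] := ev_neq0 phi; apply: (mulIf a0).
by rewrite -evM -!evi -(inj_ideal ip) evM.
Qed.

Lemma extend_inflate s phi : extend s (inflate phi) = s phi.
Proof. by rewrite /extend restrict_inflate. Qed.

Lemma inflate_continuous : continuous inflate.
Proof.
move=> phi; apply: cvg_charP => c.
exact: (@eval_continuous _ _ (p c)).
Qed.

(** The inflated characters form an open and closed set on which restriction is continuous; off it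
    the extension is zero. *)
Lemma extend_continuous s : continuous s -> continuous (extend s).
Proof.
move=> sc chi; case E: (restrict chi) => [phi|].
  have [a a0] := ev_neq0 phi.
  have nr : \forall x \near chi, restrict x <> None.
    have : \forall x \near chi, ev x (i a) != 0.
      by apply: near_ev_neq0; rewrite ev_inj_restrict E.
    by apply: filterS => x + x0; rewrite ev_inj_restrict x0 eqxx.
  (* The default [phi] only makes the map total: near [chi] the restriction exists. *)
  have rc : odflt phi (restrict x) @[x --> chi] --> phi.
    apply: cvg_charP => b.
    have : (ev x (i b) : R[i]^o) @[x --> chi] --> (ev phi b : R[i]^o).
      have -> : ev phi b = ev chi (i b) by rewrite ev_inj_restrict E.
      exact: eval_continuous.
    apply: cvg_trans; apply: (@near_eq_cvg _ _ _ (nbhs_filter chi)).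
    by apply: filterS nr => x; rewrite ev_inj_restrict; case: restrict.
  rewrite /continuous_at {2}/extend E /=.
  have : s (odflt phi (restrict x)) @[x --> chi] --> s phi.
    exact: (continuous_cvg _ (sc _) rc).
  apply: cvg_trans; apply: (@near_eq_cvg _ _ _ (nbhs_filter chi)).
  by apply: filterS nr => x; rewrite /extend; case: restrict.
rewrite /continuous_at {2}/extend E /=.
have [c c0] := ev_neq0 chi.
(* As [c - i (p c)] annihilates the ideal [i A], a character that does not
   vanish at it vanishes on [i A], and this is an open condition. *)
apply: (@cvg_near_cst _ _ _ _ _ (nbhs_filter chi)).
have : \forall x \near chi, ev x (c - i (p c)) != 0.
  by apply: near_ev_neq0; rewrite linearB /= (ev_inj_restrict _ (p c)) E subr0.
apply: filterS => x; rewrite /extend; case Ex : (restrict x) => [psi|//].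
rewrite (restrict_Some Ex) ev_inflate linearB /= (injK ip) subrr.
by rewrite linear0 eqxx.
Qed.

Lemma extend_bounded s : (exists K : R, forall phi, normc (s phi) <= K) ->
  exists K : R, forall chi, normc (extend s chi) <= K.
Proof.
(* The bound must also cover the value 0, and [K] may be negative if [A] has no characters. *)
move=> [K sK]; exists `|K| => chi; rewrite /extend; case: restrict => [phi|] /=.
  exact: le_trans (sK _) (ler_norm _).
by rewrite expr0n addr0 sqrtr0.
Qed.

Lemma BSE_functions_inflate (s : chars C -> R[i]^o) :
  @BSE_functions R C s -> @BSE_functions R A (s \o inflate).
Proof.
move=> [sc [K sK] [M [beta [Mb beta0 sM]]]]; split.
- by move=> phi; exact: (continuous_comp (@inflate_continuous phi) (sc _)).
- by exists K => phi; exact: sK.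
- exists (p @` M), beta; split=> //.
    move=> l; have [L ML] := Mb l; exists L => _ [c Mc <-].
    exact: le_trans (proj_seminorm ip l c) (ML _ Mc).
  move=> n c phi; apply: (le_trans (sM n c (inflate \o phi))).
  by rewrite /sup_on image_comp.
Qed.

(** Characters vanishing on [i A] contribute to neither side, so setting their coefficients to 0
    reduces the claim to the inequality on [A]. *)
Lemma extend_BSE_ineq (s : chars A -> R[i]^o) (M : set A) (beta : R) :
  0 < beta ->
  (forall n (c : 'I_n -> R[i]) (phi : 'I_n -> chars A),
    normc (\sum_(k < n) c k * s (phi k))
    <= beta * sup_on M (fun a => \sum_(k < n) c k * ev (phi k) a)) ->
  forall n (c : 'I_n -> R[i]) (chi : 'I_n -> chars C),
    normc (\sum_(k < n) c k * extend s (chi k))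
    <= beta * sup_on (i @` M) (fun a => \sum_(k < n) c k * ev (chi k) a).
Proof.
move=> beta0 sM n c chi.
(* [phi0] fills the indices with coefficient 0; without any character of [A] the left side is 0. *)
have [[phi0 _]|noA] := pselect (exists phi : chars A, True); last first.
  rewrite big1 ?Normc.normc0 ?mulr_ge0 ?sup_on_ge0 ?(ltW beta0)// => k _.
  rewrite /extend; case: restrict => [phi|]; last by rewrite mulr0.
  by case: noA; exists phi.
pose d k := if restrict (chi k) is Some _ then c k else 0.
have -> : \sum_(k < n) c k * extend s (chi k) =
    \sum_(k < n) d k * s (odflt phi0 (restrict (chi k))).
  apply: eq_bigr => k _; rewrite /extend /d; case: restrict => //=.
  by rewrite mulr0 mul0r.
apply: (le_trans (sM _ _ _)); rewrite /sup_on image_comp.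
rewrite le_eqVlt; apply/orP; left; apply/eqP; congr (beta * sup _).
apply: eq_imagel => a _ /=; congr normc; apply: eq_bigr => k _.
rewrite ev_inj_restrict /d; case: restrict => //=.
by rewrite mulr0 mul0r.
Qed.

(** A multiplier [T] of [C] compresses to the multiplier p T i of [A]. *)
Lemma multiplier_transforms_inflate (s : chars C -> R[i]^o) :
  @multiplier_transforms R C s -> @multiplier_transforms R A (s \o inflate).
Proof.
move=> [T [Tlin TM] [sc sT]]; exists (p \o T \o i).
  split=> [k a b|a b] /=.
    by rewrite linearP Tlin linearP.
  by rewrite injM -TM (projM ip) (injK ip).
split=> [phi|a phi].
  exact: (continuous_comp (@inflate_continuous phi) (sc _)).
have := sT (i a) (inflate phi).
by rewrite -!/(ev (inflate phi) _) !ev_inflate (injK ip).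
Qed.

Lemma ev_extend (T : A -> A) (s : chars A -> R[i]^o) (chi : chars C) a :
  multiplier_transform T s ->
  ev chi (i (T a)) = extend s chi * ev chi (i a).
Proof.
move=> [_ sT]; rewrite !ev_inj_restrict /extend.
by case: restrict => [phi|] /=; rewrite ?mul0r//; exact: sT.
Qed.

End direct_factor.

(** * Orthogonality of the two summands *)

Section direct_sum.
Variables (R : realType) (A B C : comFrechetAlgType R).
Variables (i : {linear A -> C}) (p : {linear C -> A}).
Variables (j : {linear B -> C}) (q : {linear C -> B}).

Hypotheses (ip : direct_factor i p) (jq : direct_factor j q).
Hypothesis ijC : forall c, i (p c) + j (q c) = c.

(** Decomposing i(a) gives j(q(i(a))) = 0, so q(i(a)) = 0, and the product is j(q(i(a)) b). *)
Lemma sum_orthogonal a b : amul (i a) (j b) = 0.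
Proof.
suff qi : q (i a) = 0.
  by rewrite (inj_ideal jq) qi -(scale0r (0 : B)) amulZl !scale0r linear0.
apply: (can_inj (injK jq)); rewrite linear0; apply: (addrI (i a)).
by rewrite -{1}(injK ip a) ijC addr0.
Qed.

(** A character that is nonzero on [i A] kills [j B], as products across the summands vanish. *)
Lemma extend_orthogonal (s : chars A -> R[i]^o) (chi : chars C) b :
  extend i s chi * ev chi (j b) = 0.
Proof.
rewrite /extend; case E: (restrict i chi) => [phi|]; last exact: mul0r.
have [a a0] := ev_neq0 phi.
have -> : ev chi (j b) = 0; last exact: mulr0.
apply/eqP; have/eqP := evM chi (i a) (j b).
rewrite sum_orthogonal linear0 eq_sym mulf_eq0.
by rewrite (ev_inj_restrict ip) E (negPf a0).
Qed.

End direct_sum.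

(** * Gluing functions, and the BSE property of a direct sum *)

Section direct_sum_BSE.
Variables (R : realType) (A B C : comFrechetAlgType R).
Variables (i : {linear A -> C}) (p : {linear C -> A}).
Variables (j : {linear B -> C}) (q : {linear C -> B}).

Hypotheses (ip : direct_factor i p) (jq : direct_factor j q).
Hypothesis ijC : forall c, i (p c) + j (q c) = c.

Let jiC c : j (q c) + i (p c) = c.
Proof. by rewrite addrC ijC. Qed.

Local Notation inflA := (inflate ip).
Local Notation inflB := (inflate jq).

Let extendA_inflB s psi : extend i s (inflB psi) = 0.
Proof.
have [b b0] := ev_neq0 psi; apply/eqP.
have := extend_orthogonal ip jq ijC s (inflB psi) b.
by move/eqP; rewrite mulf_eq0 ev_inflate (injK jq) (negPf b0) orbF.
Qed.

(** At most one of the two terms is nonzero at a given [chi], so the sum encodes a definition by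
    cases. *)
Definition glue (s : chars A -> R[i]^o) (t : chars B -> R[i]^o) (chi : chars C)
  : R[i]^o := extend i s chi + extend j t chi.

Lemma glue_inflate (s : chars A -> R[i]^o) (t : chars B -> R[i]^o) :
  glue s t \o inflA = s.
Proof.
apply/funext => phi; rewrite /glue /= extend_inflate.
have [a a0] := ev_neq0 phi.
suff -> : extend j t (inflA phi) = 0 by rewrite addr0.
have := extend_orthogonal jq ip jiC t (inflA phi) a.
by move/eqP; rewrite mulf_eq0 ev_inflate (injK ip) (negPf a0) orbF => /eqP.
Qed.

Lemma glue_split (sigma : chars C -> R[i]^o) :
  sigma = glue (sigma \o inflA) (sigma \o inflB).
Proof.
apply/funext => chi; rewrite /glue /extend.
case Ei: (restrict i chi) => [phi|] /=; case Ej: (restrict j chi) => [psi|] /=.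
(* If both restrictions existed, the extension of the constant 1 would be both 1 and 0 at [chi]. *)
- have := extendA_inflB (fun=> 1) psi.
  rewrite -[inflB psi](restrict_Some jq Ej) /extend Ei /= => /eqP.
  by rewrite oner_eq0.
- by rewrite addr0 -(restrict_Some ip Ei).
- by rewrite add0r -(restrict_Some jq Ej).
(* If neither existed, [chi] would vanish on both summands, hence everywhere. *)
- have [c] := ev_neq0 chi; rewrite -(ijC c) linearD /=.
  by rewrite (ev_inj_restrict ip) (ev_inj_restrict jq) Ei Ej addr0 eqxx.
Qed.

Lemma glue_continuous s t : continuous s -> continuous t ->
  continuous (glue s t).
Proof.
move=> sc tc chi.
apply: (cvgD (F := nbhs chi)).
  exact: (extend_continuous ip sc).
exact: (extend_continuous jq tc).
Qed.

Lemma BSE_functions_glue s t :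
  @BSE_functions R A s -> @BSE_functions R B t -> @BSE_functions R C (glue s t).
Proof.
move=> [sc sb [M [beta [Mb beta0 sM]]]] [tc tb [N [gamma [Nb gamma0 tN]]]].
split; first exact: glue_continuous.
  have [K sK] := extend_bounded i sb; have [L tL] := extend_bounded j tb.
  by exists (K + L) => chi; rewrite (le_trans (le_normcD _ _))// lerD.
have Ub : bounded_subset (i @` M `|` j @` N).
  move=> l; have [K MK] := Mb l; have [L NL] := Nb l.
  exists (Num.max K L) => _ [[a Ma <-]|[b Nb' <-]]; rewrite le_max; apply/orP.
    by left; exact: le_trans (inj_seminorm ip l a) (MK _ Ma).
  by right; exact: le_trans (inj_seminorm jq l b) (NL _ Nb').
(* Each half is bounded by its own constant times the supremum over the union, so the constants add
   up. *)
exists (i @` M `|` j @` N), (beta + gamma); split=> //; first exact: addr_gt0.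
move=> n c chi.
have -> : \sum_(k < n) c k * glue s t (chi k) =
    \sum_(k < n) c k * extend i s (chi k) +
    \sum_(k < n) c k * extend j t (chi k).
  by rewrite -big_split; apply: eq_bigr => k _; rewrite mulrDr.
rewrite (le_trans (le_normcD _ _))// mulrDl lerD//.
  apply: (le_trans (extend_BSE_ineq ip beta0 sM _ _)).
  by rewrite ler_pM2l//; apply: sup_on_le.
apply: (le_trans (extend_BSE_ineq jq gamma0 tN _ _)).
by rewrite ler_pM2l//; apply: sup_on_le.
Qed.

Lemma multiplier_transforms_glue s t :
  @multiplier_transforms R A s -> @multiplier_transforms R B t ->
  @multiplier_transforms R C (glue s t).
Proof.
move=> [S [Slin SM] Ss] [T [Tlin TM] Tt].
exists (fun c => i (S (p c)) + j (T (q c))).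
  split=> [k c d|c d].
    by rewrite !linearP Slin Tlin !linearP scalerDr addrACA.
  by rewrite amulDr (inj_ideal ip) (inj_ideal jq) SM TM (projM ip) (projM jq).
split; first by apply: glue_continuous; [case: Ss | case: Tt].
move=> c chi; rewrite -!/(ev chi _) linearD /= (ev_extend ip _ _ Ss).
rewrite (ev_extend jq _ _ Tt) -{3}(ijC c) linearD /glue mulrDl !mulrDr /=.
(* The cross terms of the expanded product vanish. *)
rewrite (extend_orthogonal ip jq ijC) (extend_orthogonal jq ip jiC).
by rewrite addr0 add0r.
Qed.

Lemma BSE_algebra_factor : BSE_algebra C -> BSE_algebra A.
Proof.
move=> CBSE; apply/seteqP; split=> s sP; rewrite -(glue_inflate s (fun=> 0)).
  apply: BSE_functions_inflate; rewrite -CBSE.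
  exact: multiplier_transforms_glue sP (@multiplier_transforms0 _ B).
apply: multiplier_transforms_inflate; rewrite CBSE.
exact: BSE_functions_glue sP (@BSE_functions0 _ B).
Qed.

Lemma BSE_algebra_direct_sum : BSE_algebra A -> BSE_algebra B -> BSE_algebra C.
Proof.
move=> ABSE BBSE; apply/seteqP; split=> s sP; rewrite (glue_split s).
  apply: BSE_functions_glue.
    by rewrite -ABSE; exact: multiplier_transforms_inflate.
  by rewrite -BBSE; exact: multiplier_transforms_inflate.
apply: multiplier_transforms_glue.
  by rewrite ABSE; exact: BSE_functions_inflate.
by rewrite BBSE; exact: BSE_functions_inflate.
Qed.

End direct_sum_BSE.

(** * The product algebra as a direct sum of its coordinates *)

Section product.
Variables (R : realType) (A B : comFrechetAlgType R).

Definition inl0 (a : A) : A * B := (a, 0).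
Definition inr0 (b : B) : A * B := (0, b).

Let inl0_linear : linear inl0.
Proof. by move=> k a b; congr (_, _); rewrite /= scaler0 addr0. Qed.

Let inr0_linear : linear inr0.
Proof. by move=> k a b; congr (_, _); rewrite /= scaler0 addr0. Qed.

HB.instance Definition _ :=
  GRing.isLinear.Build R[i] A (A * B)%type *:%R inl0 inl0_linear.
HB.instance Definition _ :=
  GRing.isLinear.Build R[i] B (A * B)%type *:%R inr0 inr0_linear.

Let amul0 (D : comFrechetAlgType R) (d : D) : amul d 0 = 0.
Proof. by rewrite -(scale0r (0 : D)) amulZr !scale0r. Qed.

Lemma fst_factor : @direct_factor R A (A * B)%type inl0 fst.
Proof.
split=> [[a b]|a|l c|l a|//|//|c a].
- exact: cvg_fst.
- by apply: cvg_pair; [exact: cvg_id | exact: cvg_cst].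
- by rewrite [leRHS]/seminorm /= /sum_seminorm lerDl seminorm_ge0.
- by rewrite [leLHS]/seminorm /= /sum_seminorm seminorm0 addr0.
- by congr (_, _); exact: amul0.
Qed.

Lemma snd_factor : @direct_factor R B (A * B)%type inr0 snd.
Proof.
split=> [[a b]|a|l c|l a|//|//|c a].
- exact: cvg_snd.
- by apply: cvg_pair; [exact: cvg_cst | exact: cvg_id].
- by rewrite [leRHS]/seminorm /= /sum_seminorm lerDr seminorm_ge0.
- by rewrite [leLHS]/seminorm /= /sum_seminorm seminorm0 add0r.
- by congr (_, _); exact: amul0.
Qed.

End product.

Theorem theorem2p5 (R : realType) (A B : comFrechetAlgType R)
    (ssA : semisimple A) (ssB : semisimple B) :
  BSE_algebra (A * B)%type <-> BSE_algebra A /\ BSE_algebra B.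
Proof.
have sumE (c : A * B) : inl0 B c.1 + inr0 A c.2 = c.
  by case: c => a b; congr (_, _); rewrite ?addr0 ?add0r.
(* [BSE_algebra_factor] treats the first summand, so [B] is reached with the summands exchanged. *)
have sumE' c : inr0 A c.2 + inl0 B c.1 = c by rewrite addrC sumE.
have fA := fst_factor A B; have fB := snd_factor A B.
split=> [ABBSE|[ABSE BBSE]]; last exact: BSE_algebra_direct_sum fA fB sumE _ _.
split; first exact: BSE_algebra_factor fA fB sumE _.
exact: BSE_algebra_factor fB fA sumE' _.
Qed.
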